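(* Given a number $0<d<1$ and a uniformly discrete set $\Lambda\subset\mathbb{R}$, there exist a compact set $S\subset\mathbb{R}$ of Lebesgue measure zero and functions $f_\xi\in B_S$, $\xi\in\Lambda$, with $\sup_{\xi\in\Lambda}\|f_\xi\|_{L^\infty(\mathbb{R})}<\infty$, satisfying $$\|f_\xi|_\Lambda-\delta_\xi\|_{l^\infty(\Lambda)}\le d\quad\text{for every }\xi\in\Lambda.$$ The set $S$ can be chosen depending only on $d$ and on the separation constant $\inf_{\lambda,\lambda'\in\Lambda,\lambda\neq\lambda'}|\lambda-\lambda'|$.
   Context: A set $\Lambda\subset\mathbb{R}$ is uniformly discrete if $\inf_{\lambda,\lambda'\in\Lambda,\lambda\ne\lambda'}|\lambda-\lambda'|>0$. The Fourier transform is normalized by $\hat F(x)=\int_{\mathbb{R}}e^{itx}F(t)\,dt$ (extended to Schwartz distributions). For a compact set $S\subset\mathbb{R}$, the Bernstein space $B_S$ is the space of bounded functions $f$ on $\mathbb{R}$, with the sup-norm, which are Fourier transforms of Schwartz distributions supported by $S$; such functions extend to entire functions. For $\xi\in\Lambda$, $\delta_\xi:\Lambda\to\{0,1\}$ is the function with $\delta_\xi(\xi)=1$ and $\delta_\xi(\lambda)=0$ for $\lambda\in\Lambda$, $\lambda\neq\xi$. *)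

(* Defs.v *)
From HB Require Import structures.
From mathcomp Require Import all_boot all_order all_algebra.
From mathcomp Require Import all_classical all_reals all_analysis.
From mathcomp Require Import complex.

Set Implicit Arguments.
Unset Strict Implicit.
Unset Printing Implicit Defensive.

Import Order.TTheory GRing.Theory Num.Theory.
Import numFieldNormedType.Exports.

Local Open Scope classical_set_scope.
Local Open Scope ring_scope.
Local Open Scope complex_scope.

(* The norm `|z| of z : R[i] is itself a complex number; this is the modulus
   as an element of R. *)
Definition cmod (R : realType) (z : R[i]) : R := Normc.normc z.

(* Calculus for complex-valued functions of a real variable is done on the
   real and imaginary parts, since R[i] carries no normed R-module structure. *)

Definition ccontinuous (R : realType) (f : R -> R[i]) : Prop :=
  continuous (fun x => complex.Re (f x)) /\
  continuous (fun x => complex.Im (f x)).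

Definition csmooth (R : realType) (f : R -> R[i]) : Prop :=
  forall (n : nat) (x : R),
    derivable (derive1n n (fun t => complex.Re (f t))) x 1 /\
    derivable (derive1n n (fun t => complex.Im (f t))) x 1.

Definition cderiven (R : realType) (n : nat) (f : R -> R[i]) : R -> R[i] :=
  fun x => derive1n n (fun t => complex.Re (f t)) x
           +i* derive1n n (fun t => complex.Im (f t)) x.

Definition cintegral (R : realType) (f : R -> R[i]) : R[i] :=
  (\int[lebesgue_measure]_(t in [set: R]) complex.Re (f t))
  +i* (\int[lebesgue_measure]_(t in [set: R]) complex.Im (f t)).

Definition cexpi (R : realType) (t : R) : R[i] := cos t +i* sin t.

(* The value is -oo when A is empty. *)
Definition supnorm (R : realType) (A : set R) (f : R -> R[i]) : \bar R :=
  ereal_sup [set (cmod (f x))%:E | x in A].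

Definition schwartz_seminorm (R : realType) (j k : nat) (phi : R -> R[i])
    : \bar R :=
  supnorm [set: R] (fun x => (x ^+ j)%:C * cderiven k phi x).

Definition schwartz (R : realType) (phi : R -> R[i]) : Prop :=
  csmooth phi /\ forall j k : nat, (schwartz_seminorm j k phi < +oo)%E.

Definition fsupport (R : realType) (phi : R -> R[i]) : set R :=
  closure [set x | phi x != 0].

Definition test_function (R : realType) (phi : R -> R[i]) : Prop :=
  csmooth phi /\ compact (fsupport phi).

(* A tempered distribution is represented by a functional on all functions
   R -> R[i], of which only the values on Schwartz functions are relevant. *)
Definition tempered_distribution (R : realType) (F : (R -> R[i]) -> R[i])
    : Prop :=
  (forall (a : R[i]) (phi psi : R -> R[i]), schwartz phi -> schwartz psi ->
     F (fun x => a * phi x + psi x) = a * F phi + F psi) /\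
  (exists (N : nat) (C : R), forall phi : R -> R[i], schwartz phi ->
     ((cmod (F phi))%:E <=
        C%:E * \sum_(j < N.+1) \sum_(k < N.+1) schwartz_seminorm j k phi)%E).

Definition supported_by (R : realType) (F : (R -> R[i]) -> R[i]) (S : set R)
    : Prop :=
  forall phi : R -> R[i], test_function phi ->
    fsupport phi `&` S = set0 -> F phi = 0.

Definition fourier (R : realType) (phi : R -> R[i]) : R -> R[i] :=
  fun x => cintegral (fun t => cexpi (x * t) * phi t).

(* The bounded function f, as a distribution, is the Fourier transform of F,
   defined by duality. *)
Definition is_fourier_transform (R : realType) (F : (R -> R[i]) -> R[i])
    (f : R -> R[i]) : Prop :=
  forall phi : R -> R[i], schwartz phi ->
    cintegral (fun x => f x * phi x) = F (fourier phi).

(* As a distribution f is only determined almost everywhere; continuity selects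
   the representative that extends to an entire function, so that the
   restriction of f to a discrete set is meaningful. *)
Definition bernstein (R : realType) (S : set R) (f : R -> R[i]) : Prop :=
  [/\ ccontinuous f,
      (supnorm [set: R] f < +oo)%E &
      exists F : (R -> R[i]) -> R[i],
        [/\ tempered_distribution F, supported_by F S &
            is_fourier_transform F f]].

(* The infimum is taken in the extended reals: it is +oo when L has at most
   one point. *)
Definition separation (R : realType) (L : set R) : \bar R :=
  ereal_inf [set `|p.1 - p.2|%:E |
             p in [set p : R * R | [/\ L p.1, L p.2 & p.1 <> p.2]]].

Definition uniformly_discrete (R : realType) (L : set R) : Prop :=
  (0 < separation L)%E.

Definition delta_at (R : realType) (xi : R) : R -> R[i] :=
  fun lambda => if lambda == xi then 1 else 0.

(* Main.v *)
Require Import Defs.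
From mathcomp Require Import all_boot all_order all_algebra.
From mathcomp Require Import all_classical all_reals all_analysis.
From mathcomp Require Import complex.
From mathcomp Require Import measurable_realfun.
From mathcomp Require Import ring lra.

Set Implicit Arguments.
Unset Strict Implicit.
Unset Printing Implicit Defensive.

Import Order.TTheory GRing.Theory Num.Theory.
Import numFieldNormedType.Exports.

Local Open Scope classical_set_scope.
Local Open Scope ring_scope.

(** It suffices to find one probability measure mu, carried by a compact null
    set S, whose characteristic function satisfies |mu^(x)| <= d for |x| >= sep,
    sep being the separation constant.  Then f_xi (x) = mu^(x - xi) is the
    Fourier transform of exp(- i xi t) mu, it is bounded by 1, equals 1 at xi,
    and is at most d in modulus at the other points of the set.

    The measure.  Let b = q^2, and let mu be the law of
    c (a_1 b^-1 + a_2 b^-2 + ...) with independent digits a_k uniform in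
    {0, ..., b - 2}: one digit out of b is left out.  Its support is
    self-similar, made of b - 1 copies of itself scaled by 1/b, hence null
    (measure_cantor_set).  Its characteristic function is the product over
    k >= 1 of P(c x / b^k), where P is the normalized geometric sum
    (1/m) (1 + e^{iy} + ... + e^{i(m-1)y}) with m = b - 1.

    The decay.  Every factor has modulus at most 1, so one small factor is
    enough.  The bound |P(y)| <= 2 / (m |1 - e^{iy}|) handles the y for which
    e^{iy} is at distance at least about 1/q from 1.  For 1/b <= |y| <= 1/q this
    may fail at y; if it also fails at b y, then e^{imy} = e^{iby} e^{-iy} is
    close to 1 and the numerator of P(y) = (1 - e^{imy}) / (m (1 - e^{iy})) is
    small.  So P(y) or P(b y) is at most 8/q (digit_mean_two_scales), and
    any x with |c x| > b has such a pair of factors among its scales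
    (cmod_cantor_ft_small).  Taking q large in terms of d, then c large in terms
    of sep, makes S depend on d and sep alone.

    The functional.  The measure is used only through its discrete
    approximations, the uniform means over the points with n digits, which
    already lie in S.  These means converge on Lipschitz functions at a
    geometric rate (ccvg_cantor_mean), in particular on Schwartz functions and
    on exponentials; the limit is the required tempered distribution.  The
    duality that says that mu^ is its Fourier transform is additivity of the
    integral at each finite level, followed by dominated convergence
    (fourier_cantor_distribution). *)

(** * Complex numbers and exponentials *)

Lemma eq_ReIm (R : realType) (z w : R[i]) :
  complex.Re z = complex.Re w -> complex.Im z = complex.Im w -> z = w.
Proof. by case: z w => a b [c d] /= -> ->. Qed.

Lemma ReD (R : realType) (z w : R[i]) :
  complex.Re (z + w) = complex.Re z + complex.Re w.
Proof. by case: z w => a b [c d]. Qed.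

Lemma ImD (R : realType) (z w : R[i]) :
  complex.Im (z + w) = complex.Im z + complex.Im w.
Proof. by case: z w => a b [c d]. Qed.

Lemma ReN (R : realType) (z : R[i]) : complex.Re (- z) = - complex.Re z.
Proof. by case: z. Qed.

Lemma ImN (R : realType) (z : R[i]) : complex.Im (- z) = - complex.Im z.
Proof. by case: z. Qed.

Lemma ReM (R : realType) (z w : R[i]) : complex.Re (z * w) =
  complex.Re z * complex.Re w - complex.Im z * complex.Im w.
Proof. by case: z w => a b [c d]. Qed.

Lemma ImM (R : realType) (z w : R[i]) : complex.Im (z * w) =
  complex.Re z * complex.Im w + complex.Im z * complex.Re w.
Proof. by case: z w => a b [c d]. Qed.

Lemma cmod_ge0 (R : realType) (z : R[i]) : 0 <= cmod z.
Proof. by case: z => a b; rewrite /cmod /= sqrtr_ge0. Qed.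

Lemma cmodM (R : realType) (z w : R[i]) : cmod (z * w) = cmod z * cmod w.
Proof. exact: Normc.normcM. Qed.

Lemma cmodD (R : realType) (z w : R[i]) : cmod (z + w) <= cmod z + cmod w.
Proof. exact: le_normcD. Qed.

Lemma cmodN (R : realType) (z : R[i]) : cmod (- z) = cmod z.
Proof. exact: normcN. Qed.

Lemma cmod0 (R : realType) : cmod (0 : R[i]) = 0.
Proof. exact: Normc.normc0. Qed.

Lemma cmod1 (R : realType) : cmod (1 : R[i]) = 1.
Proof. exact: Normc.normc1. Qed.

Lemma cmod0_eq0 (R : realType) (z : R[i]) : cmod z <= 0 -> z = 0.
Proof.
by move=> z0; apply: Normc.eq0_normc; apply/eqP; rewrite eq_le z0 cmod_ge0.
Qed.

Lemma cmod_nat (R : realType) (n : nat) : cmod (n%:R : R[i]) = n%:R.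
Proof. by rewrite /cmod normcMn Normc.normc1. Qed.

Lemma sqr_cmod (R : realType) (z : R[i]) :
  cmod z ^+ 2 = complex.Re z ^+ 2 + complex.Im z ^+ 2.
Proof.
by case: z => a b; rewrite /cmod /= sqr_sqrtr // addr_ge0 ?sqr_ge0.
Qed.

Lemma cmod_le (R : realType) (z : R[i]) (M : R) : 0 <= M ->
  (cmod z <= M) = (complex.Re z ^+ 2 + complex.Im z ^+ 2 <= M ^+ 2).
Proof. by move=> M0; rewrite -sqr_cmod ler_sqr // nnegrE cmod_ge0. Qed.

Lemma le_Re_cmod (R : realType) (z : R[i]) : `|complex.Re z| <= cmod z.
Proof.
rewrite -ler_sqr ?nnegrE ?cmod_ge0 // sqr_cmod real_normK ?num_real //.
by rewrite lerDl sqr_ge0.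
Qed.

Lemma le_Im_cmod (R : realType) (z : R[i]) : `|complex.Im z| <= cmod z.
Proof.
rewrite -ler_sqr ?nnegrE ?cmod_ge0 // sqr_cmod real_normK ?num_real //.
by rewrite lerDr sqr_ge0.
Qed.

Lemma cmod_le_ReIm (R : realType) (z : R[i]) :
  cmod z <= `|complex.Re z| + `|complex.Im z|.
Proof.
rewrite cmod_le ?addr_ge0 // sqrrD !real_normK ?num_real //.
by rewrite -addrA lerD2l lerDr mulrn_wge0 // mulr_ge0.
Qed.

Lemma cmod_sum (R : realType) (n : nat) (g : 'I_n -> R[i]) :
  cmod (\sum_(a < n) g a) <= \sum_(a < n) cmod (g a).
Proof.
elim/big_ind2: _ => [|x1 x2 y1 y2 h1 h2|//]; first by rewrite cmod0.
by apply: le_trans (cmodD _ _) _; exact: lerD.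
Qed.

Lemma lipschitz_of_derive (R : realType) (f : R -> R) (M : R) :
  (forall x, derivable f x 1) -> (forall x, `|derive1 f x| <= M) ->
  forall x y, `|f x - f y| <= M * `|x - y|.
Proof.
move=> df dfM.
suff H x y : x <= y -> `|f y - f x| <= M * `|y - x|.
  move=> x y; have [xy|/ltW xy] := leP x y; last exact: H.
  by rewrite distrC (distrC x); exact: H.
move=> xy.
have [||c _ ->] := @MVT_segment R f (derive1 f) x y xy.
- by move=> z _; rewrite derive1E; exact/derivableP.
- apply: continuous_subspaceT => z.
  exact/differentiable_continuous/derivable1_diffP.
by rewrite normrM ler_wpM2r.
Qed.

Lemma cos_lipschitz (R : realType) (x y : R) : `|cos x - cos y| <= `|x - y|.
Proof.
rewrite -[leRHS]mul1r; apply: lipschitz_of_derive => z.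
  exact: derivable_cos.
by rewrite derive1E derive_val normrN sin_max.
Qed.

Lemma sin_lipschitz (R : realType) (x y : R) : `|sin x - sin y| <= `|x - y|.
Proof.
rewrite -[leRHS]mul1r; apply: lipschitz_of_derive => z.
  exact: derivable_sin.
by rewrite derive1E derive_val cos_max.
Qed.

Lemma cexpiD (R : realType) (x y : R) : cexpi (x + y) = cexpi x * cexpi y.
Proof.
by apply: eq_ReIm; rewrite ?ReM ?ImM /= ?cosD ?sinD // addrC.
Qed.

Lemma cexpi0 (R : realType) : cexpi (0 : R) = 1.
Proof. by rewrite /cexpi cos0 sin0. Qed.

Lemma cexpi_natM (R : realType) (n : nat) (x : R) :
  cexpi (n%:R * x) = cexpi x ^+ n.
Proof.
elim: n => [|n IH]; first by rewrite mul0r cexpi0.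
by rewrite exprS -IH -cexpiD -natr1 mulrDl mul1r addrC.
Qed.

Lemma cmod_cexpi (R : realType) (x : R) : cmod (cexpi x) = 1.
Proof. by rewrite /cmod /= cos2Dsin2 sqrtr1. Qed.

Lemma cexpi_lipschitz (R : realType) (x y : R) :
  cmod (cexpi x - cexpi y) <= 2 * `|x - y|.
Proof.
apply: le_trans (cmod_le_ReIm _) _.
rewrite ReD ImD ReN ImN /= mulr_natl mulr2n.
by rewrite lerD ?cos_lipschitz ?sin_lipschitz.
Qed.

Lemma cmod_1Bcexpi_le2 (R : realType) (x : R) : cmod (1 - cexpi x) <= 2.
Proof.
by apply: le_trans (cmodD _ _) _; rewrite cmodN cmod1 cmod_cexpi.
Qed.

(** On [0, 1] the derivative cos x >= 1 - x^2/2 is at least 1/2. *)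
Lemma sin_ge_half (R : realType) (x : R) : 0 <= x -> x <= 1 -> x / 2 <= sin x.
Proof.
move=> x0 x1.
have sin_le (y : R) : 0 <= y -> `|sin y| <= y.
  by move=> y0; have := sin_lipschitz y 0; rewrite sin0 !subr0 (ger0_norm y0).
have [|z zx] := @MVT_segment R sin cos 0 x x0.
  by apply: continuous_subspaceT => z; exact: continuous_sin.
rewrite sin0 !subr0 => ->.
move: zx; rewrite in_itv /= => /andP[z0 zx].
rewrite mulrC ler_wpM2r //.
(* cos z = 1 - 2 sin^2 (z/2) and 0 <= z/2 <= 1/2 *)
have -> : z = (z / 2) *+ 2 by rewrite -mulr_natr divfK.
rewrite cos_mulr2n cos2sin2.
have sz := sin_le (z / 2) ltac:(lra).
have : sin (z / 2) ^+ 2 <= (1 / 2) ^+ 2.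
  rewrite -real_normK ?num_real // ler_sqr ?nnegrE //; lra.
rewrite -mulr_natr; lra.
Qed.

Lemma cmod_1Bcexpi_ge (R : realType) (x : R) :
  `|x| <= 1 -> `|x| / 2 <= cmod (1 - cexpi x).
Proof.
move=> x1; apply: le_trans (le_Im_cmod _).
rewrite ImD ImN /= sub0r normrN.
have -> : `|sin x| = `|sin `|x| |.
  by case: (lerP 0 x) => [/ger0_norm -> //|/ltr0_norm ->]; rewrite sinN normrN.
by apply: le_trans (ler_norm _); exact: sin_ge_half.
Qed.

(** * The characteristic function of a digit *)

(** The characteristic function of a digit uniformly distributed in
    {0, ..., m - 1}. *)
Definition digit_mean (R : realType) (m : nat) (y : R) : R[i] :=
  m%:R^-1 * \sum_(a < m) cexpi (a%:R * y).

Lemma natC_neq0 (R : realType) (m : nat) : (0 < m)%N -> m%:R != 0 :> R[i].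
Proof. by rewrite pnatr_eq0 lt0n. Qed.

Lemma digit_mean_geometric (R : realType) (m : nat) (y : R) : (0 < m)%N ->
  m%:R * digit_mean m y * (1 - cexpi y) = 1 - cexpi (m%:R * y).
Proof.
move=> m0; rewrite /digit_mean mulrA mulfV ?natC_neq0 // mul1r.
rewrite cexpi_natM -[X in _ = X - _](expr1n _ m) subrXX mulrC; congr (_ * _).
by apply: eq_bigr => a _; rewrite expr1n mul1r cexpi_natM.
Qed.

Lemma cmod_digit_mean_le1 (R : realType) (m : nat) (y : R) : (0 < m)%N ->
  cmod (digit_mean m y) <= 1.
Proof.
move=> m0; rewrite -(@ler_pM2l _ m%:R) ?ltr0n // -{1}cmod_nat -cmodM.
rewrite /digit_mean mulrA mulfV ?natC_neq0 // mul1r mulr1.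
apply: le_trans (cmod_sum _) _.
under eq_bigr do rewrite cmod_cexpi.
by rewrite sumr_const card_ord.
Qed.

(** Put b = q^2 and m = b - 1.  By the geometric sum, digit_mean m is small
    where exp(iy) is far from 1.  If y is close to 0 while exp(iby) is also
    close to 1, then exp(imy) = exp(iby) exp(-iy) is close to 1 too and the
    numerator of the geometric sum is small.  This is what omitting exactly
    one of the b digits achieves. *)
Lemma digit_mean_two_scales (R : realType) (q : nat) (y : R) :
  (1 < q)%N -> `|y| <= 1 -> 1 <= (q ^ 2)%:R * `|y| ->
  cmod (digit_mean (q ^ 2).-1 y) <= 8 / q%:R \/
  cmod (digit_mean (q ^ 2).-1 ((q ^ 2)%:R * y)) <= 8 / q%:R.
Proof.
move=> q1 y1; set m := (q ^ 2).-1.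
have q2 : (2 : R) <= q%:R by rewrite ler_nat.
have m0 : (0 < m)%N by rewrite /m -subn1 subn_gt0 (ltn_exp2l 0).
have bE : (q ^ 2)%:R = m%:R + 1 :> R.
  by rewrite natr1 /m prednK // expn_gt0 (ltnW q1).
rewrite bE => by1.
have mE : m%:R = q%:R ^+ 2 - 1 :> R by rewrite -natrX bE addrK.
have geo (z : R) : m%:R * cmod (digit_mean m z) * cmod (1 - cexpi z)
    = cmod (1 - cexpi (m%:R * z)).
  by rewrite -digit_mean_geometric // !cmodM cmod_nat.
have m0R : 0 < m%:R :> R by rewrite ltr0n.
(* far from 1, the numerator of the geometric sum is at most 2 *)
have far (z s : R) : 0 < s -> s / q%:R <= cmod (1 - cexpi z) ->
    s * cmod (digit_mean m z) * m%:R <= 2 * q%:R.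
  move=> s0 hz; rewrite -ler_pdivrMr; last lra.
  apply: le_trans (cmod_1Bcexpi_le2 (m%:R * z)); rewrite -geo.
  rewrite [leLHS](_ : _ = m%:R * cmod (digit_mean m z) * (s / q%:R)).
    by rewrite ler_wpM2l // mulr_ge0 // ?cmod_ge0 // ltW.
  by ring.
set D := cmod (digit_mean m y) in far geo *.
rewrite !ler_pdivlMr; try lra.
have [yq|yq] := leP 1 (q%:R * `|y|).
  left; have := far y (1 / 2) ltac:(lra) _; rewrite -/D mE => far1.
  have /far1 : 1 / 2 / q%:R <= cmod (1 - cexpi y).
    apply: le_trans (cmod_1Bcexpi_ge y1).
    rewrite mulrAC ler_wpM2r ?invr_ge0 // ler_pdivrMr; [lra|lra].
  have := cmod_ge0 (digit_mean m y); rewrite -/D; nra.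
have [hz|hz] := leP (1 / q%:R) (cmod (1 - cexpi ((m%:R + 1) * y))).
  right; have /far : 1 / q%:R <= cmod (1 - cexpi ((m%:R + 1) * y)) by [].
  move=> /(_ ltac:(lra)); rewrite mE.
  have := cmod_ge0 (digit_mean m ((m%:R + 1) * y)); rewrite mE; nra.
left.
have num : cmod (1 - cexpi (m%:R * y)) <= 3 / q%:R.
  have -> : cmod (1 - cexpi (m%:R * y)) =
      cmod ((cexpi y - cexpi 0) + (1 - cexpi ((m%:R + 1) * y))).
    rewrite -[LHS]mul1r -{1}(cmod_cexpi y) -cmodM mulrBr mulr1 -cexpiD.
    rewrite cexpi0 addrA subrK; congr (cmod (_ - cexpi _)); by ring.
  apply: le_trans (cmodD _ _) _.
  have := cexpi_lipschitz y 0; rewrite subr0.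
  have : `|y| <= 1 / q%:R by rewrite ler_pdivlMr; lra.
  by rewrite !mul1r in hz *; lra.
have den := cmod_1Bcexpi_ge y1.
move: num; rewrite -geo -/D ler_pdivlMr; last lra.
have D0 : 0 <= D := cmod_ge0 _.
have : D * (1 / (m%:R + 1) / 2) <= D * cmod (1 - cexpi y).
  rewrite ler_wpM2l //; apply: le_trans den.
  by rewrite ler_wpM2r // ler_pdivrMr; lra.
rewrite mulrA ler_pdivrMr // mulrA mulr1 ler_pdivrMr; last lra.
rewrite mE; set E := cmod _ => h1 h2.
have D1 : D <= 1 by exact: cmod_digit_mean_le1.
nra.
Qed.

(** * The self-similar measure and its support *)

Definition digit_map (R : realType) (m : nat) (c : R) (a : nat) (t : R) : R :=
  (c * a%:R + t) / m.+1%:R.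

(** The mean of g over the m^n points c (a_1 b^-1 + ... + a_n b^-n), where
    b = m + 1 and the digits a_i run over {0, ..., m - 1}. *)
Fixpoint cantor_mean (R : realType) (m : nat) (c : R) (n : nat)
    (g : R -> R[i]) : R[i] :=
  if n is k.+1 then
    m%:R^-1 * \sum_(a < m) cantor_mean m c k (fun t => g (digit_map m c a t))
  else g 0.

(** The supports of the successive stages, starting from a whole interval rather
    than from a point so that they decrease to cantor_set. *)
Fixpoint cantor_level (R : realType) (m : nat) (c : R) (n : nat) : set R :=
  if n is k.+1 then
    \big[setU/set0]_(a < m) (digit_map m c a @` cantor_level m c k)
  else `[0, c].

Definition cantor_set (R : realType) (m : nat) (c : R) : set R :=
  \bigcap_n cantor_level m c n.

Lemma digit_map_itv (R : realType) (m : nat) (c t : R) (a : nat) :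
  0 <= c -> (a < m)%N -> 0 <= t -> t <= c ->
  0 <= digit_map m c a t <= c.
Proof.
move=> c0 am t0 tc; have a0 : 0 <= a%:R :> R by [].
have am' : a%:R + 1 <= m%:R :> R by rewrite natr1 ler_nat.
rewrite /digit_map -natr1 divr_ge0 ?addr_ge0 ?mulr_ge0 //=.
rewrite ler_pdivrMr; last by rewrite ltr_wpDl.
have : c * (a%:R + 1) <= c * m%:R by rewrite ler_wpM2l.
lra.
Qed.

Lemma cantor_levelS_digit (R : realType) (m : nat) (c t : R) (a n : nat) :
  (a < m)%N -> cantor_level m c n t ->
  cantor_level m c n.+1 (digit_map m c a t).
Proof.
move=> am Kt; rewrite /= -bigcup_seq.
by exists (Ordinal am) => /=; [rewrite mem_index_enum | exists t].
Qed.

Lemma cantor_level_inv (R : realType) (m : nat) (c t : R) (n : nat) :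
  cantor_level m c n.+1 t ->
  exists2 a, (a < m)%N &
    exists2 s, cantor_level m c n s & digit_map m c a s = t.
Proof.
by rewrite /= -bigcup_seq => -[a _ [s Ks st]]; exists a => //; exists s.
Qed.

Lemma cantor_level_itv (R : realType) (m : nat) (c : R) (n : nat) (t : R) :
  0 <= c -> cantor_level m c n t -> 0 <= t <= c.
Proof.
move=> c0; elim: n t => [|n IH] t; first by rewrite /= in_itv.
move=> /cantor_level_inv[a am [s /IH/andP[s0 sc] <-]].
exact: digit_map_itv.
Qed.

Lemma cantor_set0 (R : realType) (m : nat) (c : R) : (0 < m)%N -> 0 <= c ->
  cantor_set m c 0.
Proof.
move=> m0 c0 n _; elim: n => [|n IH]; first by rewrite /= in_itv /= lexx.
have := cantor_levelS_digit m0 IH.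
by rewrite /digit_map mulr0 addr0 mul0r.
Qed.

Lemma cantor_set_digit (R : realType) (m : nat) (c t : R) (a : nat) :
  0 <= c -> (a < m)%N -> cantor_set m c t ->
  cantor_set m c (digit_map m c a t).
Proof.
move=> c0 am Kt [|n] _; last exact/cantor_levelS_digit/Kt.
have /(cantor_level_itv c0)/andP[t0 tc] := Kt 0%N I.
by rewrite /= in_itv /=; exact: digit_map_itv.
Qed.

Lemma digit_map_continuous (R : realType) (m : nat) (c : R) (a : nat) :
  continuous (digit_map m c a).
Proof.
move=> x; apply: cvgM; last exact: cvg_cst.
by apply: cvgD; [exact: cvg_cst|exact: cvg_id].
Qed.

Lemma compact_cantor_level (R : realType) (m : nat) (c : R) (n : nat) :
  compact (cantor_level m c n).
Proof.
elim: n => [|n IH]; first exact: segment_compact.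
apply: bigsetU_compact => a _.
apply: continuous_compact IH.
by apply: continuous_subspaceT => x; exact: digit_map_continuous.
Qed.

Lemma compact_cantor_set (R : realType) (m : nat) (c : R) :
  compact (cantor_set m c).
Proof.
apply: (@subclosed_compact _ _ (cantor_level m c 0)).
- apply: closed_bigI => n _; apply: compact_closed; first exact: Rhausdorff.
  exact: compact_cantor_level.
- exact: compact_cantor_level.
- exact: bigcap_inf.
Qed.

(** Each level is a union of m copies of the previous one, scaled by
    1 / (m + 1).  Stating the bound for all affine images makes the induction
    go through the compositions of the digit maps. *)
Lemma measure_affine_cantor_level (R : realType) (m : nat) (c : R) (n : nat)
    (s r : R) : 0 <= c -> 0 <= r ->
  (lebesgue_measure ((fun t => (s + r * t)%R) @` cantor_level m c n) <=
    (r * c * (m%:R / m.+1%:R) ^+ n)%:E)%E.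
Proof.
move=> c0; elim: n s r => [|n IH] s r r0.
  rewrite expr0 mulr1.
  apply: (@le_trans _ _ (lebesgue_measure `[s, s + r * c])).
    apply: le_measure; rewrite ?inE //.
      apply: compact_measurable; apply: continuous_compact.
        apply: continuous_subspaceT => x; apply: cvgD; first exact: cvg_cst.
        by apply: cvgM; [exact: cvg_cst|exact: cvg_id].
      exact: compact_cantor_level.
    move=> x [t] /=; rewrite !in_itv /= => /andP[t0 tc] <-.
    by rewrite lerDl mulr_ge0 //= lerD2l ler_wpM2l.
  rewrite lebesgue_measure_itv /= lte_fin.
  case: ifPn => _; last by rewrite lee_fin mulr_ge0.
  by rewrite -EFinB addrAC subrr add0r.
have aff (a : 'I_m) :
    (fun t => s + r * t) @` (digit_map m c a @` cantor_level m c n) =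
    (fun t => (s + r * (c * a%:R / m.+1%:R)) + r / m.+1%:R * t) @`
      cantor_level m c n.
  rewrite image_comp; congr (_ @` _); apply/funext => t /=.
  by rewrite /digit_map; ring.
have img (g : R -> R) (F : nat -> set R) : g @` (\big[setU/set0]_(a < m) F a)
    = \big[setU/set0]_(a < m) (g @` F a).
  exact: (big_morph (fun A => g @` A) (image_setU g) (image_set0 g)).
rewrite [cantor_level _ _ _]/=.
rewrite (img _ (fun a => digit_map m c a @` cantor_level m c n)).
have Boole := @Boole_inequality _ R _ (@lebesgue_measure R)
  (fun a => (fun t => s + r * t) @` (digit_map m c a @` cantor_level m c n)) m.
apply: (le_trans (Boole _)).
  move=> a am; rewrite /= (aff (Ordinal am)); apply: compact_measurable.
  apply: continuous_compact; last exact: compact_cantor_level.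
  apply: continuous_subspaceT => x; apply: cvgD; first exact: cvg_cst.
  by apply: cvgM; [exact: cvg_cst|exact: cvg_id].
have r1 : 0 <= r / m.+1%:R by rewrite divr_ge0.
apply: (@le_trans _ _ (\sum_(a < m)
    (r / m.+1%:R * c * (m%:R / m.+1%:R) ^+ n)%:E)%E).
  by apply: lee_sum => a _; rewrite aff; exact: IH.
rewrite sumEFin sumr_const card_ord lee_fin exprS -mulr_natr.
by rewrite le_eqVlt; apply/orP; left; apply/eqP; ring.
Qed.

Lemma measure_cantor_set (R : realType) (m : nat) (c : R) : 0 <= c ->
  lebesgue_measure (cantor_set m c) = 0%E.
Proof.
move=> c0; apply/eqP; rewrite eq_le measure_ge0 andbT.
have le_level n : (lebesgue_measure (cantor_set m c) <=
    (c * (m%:R / m.+1%:R) ^+ n)%:E)%E.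
  have := @measure_affine_cantor_level R m c n 0 1 c0 ler01.
  rewrite mul1r; apply: le_trans.
  apply: le_measure; rewrite ?inE.
  - by apply: compact_measurable; exact: compact_cantor_set.
  - apply: compact_measurable.
    apply: continuous_compact; last exact: compact_cantor_level.
    apply: continuous_subspaceT => x; apply: cvgD; first exact: cvg_cst.
    by apply: cvgM; [exact: cvg_cst|exact: cvg_id].
  - move=> t /(_ n I) Kt; exists t => //; by rewrite add0r mul1r.
have cvg0 : (c * (m%:R / m.+1%:R) ^+ n)%:E @[n --> \oo] --> (0 : R)%:E.
  apply: cvg_EFin; first exact: nearW.
  rewrite -[X in _ --> X](mulr0 c); apply: cvgM; first exact: cvg_cst.
  apply: cvg_expr; rewrite ger0_norm ?divr_ge0 //.
  by rewrite ltr_pdivrMr ?ltr0n // mul1r ltr_nat.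
by apply: cvge_ge cvg0; exact: nearW.
Qed.

(** * Means over the levels and their limits *)

Lemma cantor_mean_linear (R : realType) (m : nat) (c : R) (n : nat)
    (z : R[i]) (g h : R -> R[i]) :
  cantor_mean m c n (fun t => z * g t + h t) =
  z * cantor_mean m c n g + cantor_mean m c n h.
Proof.
elim: n g h => [//|n IH] g h /=.
under eq_bigr do rewrite IH.
by rewrite big_split /= -mulr_sumr mulrDr mulrCA.
Qed.

Lemma cantor_mean_cst (R : realType) (m : nat) (c : R) (n : nat) (z : R[i]) :
  (0 < m)%N -> cantor_mean m c n (fun=> z) = z.
Proof.
move=> m0; elim: n => [//|n IH] /=; under eq_bigr do rewrite IH.
by rewrite sumr_const card_ord -[z *+ m]mulr_natl mulKf ?natC_neq0.
Qed.

Lemma cantor_meanZ (R : realType) (m : nat) (c : R) (n : nat)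
    (z : R[i]) (g : R -> R[i]) :
  cantor_mean m c n (fun t => z * g t) = z * cantor_mean m c n g.
Proof.
elim: n g => [//|n IH] g /=; under eq_bigr do rewrite IH.
by rewrite -mulr_sumr mulrCA.
Qed.

Lemma cantor_meanB (R : realType) (m : nat) (c : R) (n : nat)
    (g h : R -> R[i]) :
  cantor_mean m c n (fun t => g t - h t) =
  cantor_mean m c n g - cantor_mean m c n h.
Proof.
have -> : (fun t => g t - h t) = (fun t => -1 * h t + g t).
  by apply/funext => t; rewrite mulN1r addrC.
by rewrite cantor_mean_linear mulN1r addrC.
Qed.

Lemma cmod_digit_average (R : realType) (m : nat) (u : 'I_m -> R[i]) (M : R) :
  (0 < m)%N -> (forall a, cmod (u a) <= M) ->
  cmod (m%:R^-1 * \sum_a u a) <= M.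
Proof.
move=> m0 uM; rewrite -(@ler_pM2l _ m%:R) ?ltr0n // -{1}cmod_nat -cmodM.
rewrite mulrA mulfV ?natC_neq0 // mul1r.
apply: le_trans (cmod_sum _) _.
apply: le_trans (ler_sum _ (fun a _ => uM a)) _.
by rewrite sumr_const card_ord mulr_natl.
Qed.

Lemma cmod_cantor_mean_le (R : realType) (m : nat) (c : R) (A : set R)
    (n : nat) (g : R -> R[i]) (M : R) : (0 < m)%N ->
  A 0 -> (forall (a : nat) t, (a < m)%N -> A t -> A (digit_map m c a t)) ->
  (forall t, A t -> cmod (g t) <= M) -> cmod (cantor_mean m c n g) <= M.
Proof.
move=> m0 A0 Ad; elim: n g => [|n IH] g gM /=; first exact: gM.
by apply: cmod_digit_average => // a; apply: IH => t At; apply/gM/Ad.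
Qed.

(** Keeping the first n digits of a point of level n + p moves it by at most
    c b^-n.  The induction is on the leading digit, so that the error of level 0
    is contracted n times; the case n = 0 holds as all points lie in [0, c]. *)
Lemma cantor_mean_cauchy (R : realType) (m : nat) (c : R) (n p : nat)
    (g : R -> R[i]) (M : R) : (0 < m)%N -> 0 <= c -> 0 <= M ->
  (forall s t, cmod (g s - g t) <= M * `|s - t|) ->
  cmod (cantor_mean m c (n + p) g - cantor_mean m c n g)
    <= M * c / m.+1%:R ^+ n.
Proof.
move=> m0 c0; elim: n g M => [|n IH] g M M0 gM.
  rewrite expr0 divr1 -[cantor_mean m c 0 g](cantor_mean_cst c p _ m0).
  rewrite add0n -cantor_meanB.
  apply: (@cmod_cantor_mean_le _ _ _ `[0, c]%classic) => //=.
  - by rewrite in_itv /= lexx.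
  - by move=> a t am; rewrite !in_itv /= => /andP[]; exact: digit_map_itv.
  - move=> t; rewrite in_itv /= => /andP[t0 tc].
    by apply: le_trans (gM _ _) _; rewrite subr0 ger0_norm // ler_wpM2l.
rewrite addSn /= -mulrBr -sumrB.
apply: cmod_digit_average => // a.
(* on each of the m pieces g is composed with a contraction of ratio 1/b *)
have -> : M * c / m.+1%:R ^+ n.+1 = M / m.+1%:R * c / m.+1%:R ^+ n.
  by rewrite exprS invfM; ring.
apply: IH; first by rewrite divr_ge0.
move=> s t; apply: le_trans (gM _ _) _.
rewrite -mulrA ler_wpM2l // /digit_map -mulrBl opprD addrACA subrr add0r.
by rewrite normrM [X in _ * X]ger0_norm ?invr_ge0 // mulrC.
Qed.

Definition ccvg (R : realType) (u : nat -> R[i]) (l : R[i]) : Prop :=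
  complex.Re (u n) @[n --> \oo] --> complex.Re l /\
  complex.Im (u n) @[n --> \oo] --> complex.Im l.

Definition clim (R : realType) (u : nat -> R[i]) : R[i] :=
  Complex (lim (complex.Re (u n) @[n --> \oo]))
          (lim (complex.Im (u n) @[n --> \oo])).

Lemma ccvg_clim (R : realType) (u : nat -> R[i]) (l : R[i]) :
  ccvg u l -> clim u = l.
Proof. by case: l => a b [/cvg_lim ua /cvg_lim ub]; rewrite /clim ua ?ub. Qed.

Lemma ccvg_cst (R : realType) (z : R[i]) : ccvg (fun=> z) z.
Proof. by split; exact: cvg_cst. Qed.

Lemma ccvg_linear (R : realType) (z k l : R[i]) (u v : nat -> R[i]) :
  ccvg u k -> ccvg v l -> ccvg (fun n => z * u n + v n) (z * k + l).
Proof.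
move=> [uk1 uk2] [vl1 vl2]; split.
  under eq_fun do rewrite ReD ReM.
  rewrite ReD ReM.
  by apply: cvgD => //; apply: cvgB; apply: cvgM => //; exact: cvg_cst.
under eq_fun do rewrite ImD ImM.
rewrite ImD ImM.
by apply: cvgD => //; apply: cvgD; apply: cvgM => //; exact: cvg_cst.
Qed.

Lemma ccvg_cmod_le (R : realType) (u : nat -> R[i]) (l : R[i]) (M : R) :
  ccvg u l -> (\forall n \near \oo, cmod (u n) <= M) -> cmod l <= M.
Proof.
move=> [u1 u2] uM.
have M0 : 0 <= M.
  have [n] := @filter_ex _ _ _ _ uM; exact/le_trans/cmod_ge0.
rewrite cmod_le //.
have sq : complex.Re (u n) ^+ 2 + complex.Im (u n) ^+ 2 @[n --> \oo] -->
    complex.Re l ^+ 2 + complex.Im l ^+ 2.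
  by apply: cvgD; rewrite expr2; under eq_fun do rewrite expr2; exact: cvgM.
apply: (cvgr_to_le sq); apply: filterS uM => n.
by rewrite cmod_le.
Qed.

Lemma cvg_of_geometric_cauchy (R : realType) (u : nat -> R) (M r : R) :
  0 <= r -> r < 1 -> (forall n p, `|u (n + p)%N - u n| <= M * r ^+ n) ->
  cvgn u.
Proof.
move=> r0 r1 uM; apply: cauchy_cvg; apply: cauchy_exP => e e0.
have Mr : M * r ^+ n @[n --> \oo] --> (0 : R).
  rewrite -[X in _ --> X](mulr0 M); apply: cvgM; first exact: cvg_cst.
  by apply: cvg_expr; rewrite ger0_norm.
have /cvgr0_norm_lt/(_ _ e0)[n _ nP] := Mr.
exists (u n), n => // k nk; rewrite /ball /= distrC -(subnKC nk).
apply: le_lt_trans (uM n _) _; apply: le_lt_trans (ler_norm _) _.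
by apply: nP => /=.
Qed.

(** For a Lipschitz g the means form a Cauchy sequence, so that the limit is the
    integral of g against the self-similar measure. *)
Lemma ccvg_cantor_mean (R : realType) (m : nat) (c : R) (g : R -> R[i])
    (M : R) : (0 < m)%N -> 0 <= c -> 0 <= M ->
  (forall s t, cmod (g s - g t) <= M * `|s - t|) ->
  ccvg (fun n => cantor_mean m c n g) (clim (fun n => cantor_mean m c n g)).
Proof.
move=> m0 c0 M0 gM.
have r0 : 0 <= m.+1%:R^-1 :> R by rewrite invr_ge0.
have r1 : m.+1%:R^-1 < 1 :> R by rewrite invf_lt1 ?ltr0n // ltr1n.
have H n p : cmod (cantor_mean m c (n + p) g - cantor_mean m c n g)
    <= M * c * m.+1%:R^-1 ^+ n.
  by rewrite exprVn; exact: cantor_mean_cauchy.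
split; apply: (@cvg_of_geometric_cauchy _ _ (M * c) _ r0 r1) => n p;
  apply: le_trans (H n p); [rewrite -ReN -ReD|rewrite -ImN -ImD].
  exact: le_Re_cmod.
exact: le_Im_cmod.
Qed.

(** * The characteristic function *)

Definition cantor_char (R : realType) (m : nat) (c : R) (n : nat) (x : R) :
    R[i] :=
  cantor_mean m c n (fun t => cexpi (x * t)).

Definition cantor_ft (R : realType) (m : nat) (c : R) (x : R) : R[i] :=
  clim (fun n => cantor_char m c n x).

Lemma cantor_charS (R : realType) (m : nat) (c : R) (n : nat) (x : R) :
  cantor_char m c n.+1 x =
  digit_mean m (c * x / m.+1%:R) * cantor_char m c n (x / m.+1%:R).
Proof.
rewrite /cantor_char /digit_mean /= -[RHS]mulrA mulr_suml; congr (_ * _).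
apply: eq_bigr => a _; rewrite -cantor_meanZ; congr cantor_mean.
by apply/funext => t; rewrite -cexpiD /digit_map; congr cexpi; ring.
Qed.

Lemma cmod_cantor_char_le1 (R : realType) (m : nat) (c : R) (n : nat) (x : R) :
  (0 < m)%N -> cmod (cantor_char m c n x) <= 1.
Proof.
move=> m0; apply: (@cmod_cantor_mean_le _ _ _ setT) => // t _.
by rewrite cmod_cexpi.
Qed.

(** Of the product of n factors given by cantor_charS, all but one are bounded
    by 1. *)
Lemma cmod_cantor_char_le_digit_mean (R : realType) (m : nat) (c : R)
    (k n : nat) (x : R) : (0 < m)%N -> (k < n)%N ->
  cmod (cantor_char m c n x) <= cmod (digit_mean m (c * x / m.+1%:R ^+ k.+1)).
Proof.
move=> m0; elim: k n x => [|k IH] [//|n] x kn; rewrite cantor_charS cmodM.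
  rewrite expr1 -[leRHS]mulr1 ler_wpM2l ?cmod_ge0 //.
  exact: cmod_cantor_char_le1.
rewrite -[leRHS]mul1r ler_pM ?cmod_ge0 ?cmod_digit_mean_le1 //.
by rewrite exprS invfM mulrA -[c * x / _]mulrA; exact: IH.
Qed.

Lemma ccvg_cantor_char (R : realType) (m : nat) (c x : R) :
  (0 < m)%N -> 0 <= c ->
  ccvg (fun n => cantor_char m c n x) (cantor_ft m c x).
Proof.
move=> m0 c0; apply: (@ccvg_cantor_mean _ _ _ _ (2 * `|x|)) => //.
move=> s t; apply: le_trans (cexpi_lipschitz _ _) _.
by rewrite -mulrBr normrM mulrA.
Qed.

Lemma cmod_cantor_ft_le1 (R : realType) (m : nat) (c x : R) :
  (0 < m)%N -> 0 <= c -> cmod (cantor_ft m c x) <= 1.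
Proof.
move=> m0 c0; apply: (ccvg_cmod_le (ccvg_cantor_char x m0 c0)).
by apply: nearW => n; exact: cmod_cantor_char_le1.
Qed.

Lemma cantor_ft0 (R : realType) (m : nat) (c : R) :
  (0 < m)%N -> cantor_ft m c 0 = 1.
Proof.
move=> m0; apply: ccvg_clim; rewrite (_ : (fun n => _) = fun=> 1).
  exact: ccvg_cst.
apply/funext => n; rewrite /cantor_char.
under eq_fun do rewrite mul0r cexpi0.
exact: cantor_mean_cst.
Qed.

Lemma cantor_char_lipschitz (R : realType) (m : nat) (c : R) (n : nat)
    (x y : R) : (0 < m)%N -> 0 <= c ->
  cmod (cantor_char m c n x - cantor_char m c n y) <= 2 * c * `|x - y|.
Proof.
move=> m0 c0; rewrite -cantor_meanB.
apply: (@cmod_cantor_mean_le _ _ _ `[0, c]%classic) => //=.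
- by rewrite in_itv /= lexx.
- by move=> a t am; rewrite !in_itv /= => /andP[]; exact: digit_map_itv.
- move=> t; rewrite in_itv /= => /andP[t0 tc].
  apply: le_trans (cexpi_lipschitz _ _) _.
  by rewrite -mulrBl normrM (ger0_norm t0) -mulrA ler_wpM2l // mulrC ler_wpM2r.
Qed.

Lemma cantor_ft_lipschitz (R : realType) (m : nat) (c x y : R) :
  (0 < m)%N -> 0 <= c ->
  cmod (cantor_ft m c x - cantor_ft m c y) <= 2 * c * `|x - y|.
Proof.
move=> m0 c0.
have := ccvg_linear (-1) (ccvg_cantor_char y m0 c0) (ccvg_cantor_char x m0 c0).
rewrite mulN1r [- _ + _]addrC => /ccvg_cmod_le; apply.
apply: nearW => n; rewrite mulN1r [- _ + _]addrC.
exact: cantor_char_lipschitz.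
Qed.

(** Descending the scales x, x/b, x/b^2, ... until they become at most 1
    reaches a pair of consecutive scales where one factor of the product is
    small; the largeness of c x ensures that both factors occur. *)
Lemma cmod_cantor_ft_small (R : realType) (q : nat) (c x : R) : (1 < q)%N ->
  0 <= c -> (q ^ 2)%:R < `|c * x| ->
  cmod (cantor_ft (q ^ 2).-1 c x) <= 8 / q%:R.
Proof.
move=> q1 c0 cx; set m := (q ^ 2).-1.
have b1 : (1 < q ^ 2)%N by rewrite (ltn_exp2l 0).
have m0 : (0 < m)%N by rewrite /m -subn1 subn_gt0.
have bE : m.+1 = (q ^ 2)%N by rewrite prednK // ltnW.
have b0 : 0 < (q ^ 2)%:R :> R by rewrite ltr0n ltnW.
have bound k : cmod (digit_mean m (c * x / (q ^ 2)%:R ^+ k.+1)) <= 8 / q%:R ->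
    cmod (cantor_ft m c x) <= 8 / q%:R.
  move=> small; apply: (ccvg_cmod_le (ccvg_cantor_char x m0 c0)).
  exists k.+1 => // n /= kn; apply: le_trans small.
  by rewrite -bE; exact: cmod_cantor_char_le_digit_mean.
pose P k := `|c * x| <= (q ^ 2)%:R ^+ k.
have exP : exists k, P k.
  exists (Num.truncn `|c * x|).+1; rewrite /P -natrX.
  apply: ltW; apply: lt_le_trans (truncnS_gt _) _.
  by rewrite ler_nat ltnW // ltn_expl.
case: (ex_minnP exP) => -[|[|k]] Pk kmin.
- by move: Pk; rewrite /P expr0 leNgt (lt_trans _ cx) // ltr1n.
- by move: Pk; rewrite /P expr1 leNgt cx.
have : ~~ P k.+1 by apply/negP => /kmin; rewrite ltnn.
rewrite /P -ltNge => Pk'.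
pose y := c * x / (q ^ 2)%:R ^+ k.+2.
have ny : `|y| = `|c * x| / (q ^ 2)%:R ^+ k.+2.
  by rewrite normrM normfV [X in _ / X]ger0_norm // exprn_ge0 // ltW.
have byE : (q ^ 2)%:R * y = c * x / (q ^ 2)%:R ^+ k.+1.
  rewrite /y [_ ^+ k.+2]exprS; field.
  by rewrite expf_neq0 ?lt0r_neq0 //= ltr0n ltnW.
have [] := @digit_mean_two_scales R q y q1.
- by rewrite ny ler_pdivrMr ?exprn_gt0 // mul1r.
- rewrite -[X in X * _](ger0_norm (ltW b0)) -normrM byE normrM normfV.
  rewrite [X in _ / X]ger0_norm ?exprn_ge0 ?(ltW b0) //.
  by rewrite ler_pdivlMr ?exprn_gt0 // mul1r ltW.
- exact: (bound k.+1).
- by rewrite byE; exact: (bound k).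
Qed.

(** * Integration of complex-valued functions *)

Definition cintegrable (R : realType) (g : R -> R[i]) : Prop :=
  lebesgue_measure.-integrable setT (EFin \o (fun x => complex.Re (g x))) /\
  lebesgue_measure.-integrable setT (EFin \o (fun x => complex.Im (g x))).

Lemma integrable_comb (R : realType) (a b : R) (u v : R -> R) :
  lebesgue_measure.-integrable setT (EFin \o u) ->
  lebesgue_measure.-integrable setT (EFin \o v) ->
  lebesgue_measure.-integrable setT (EFin \o (fun x => a * u x + b * v x)).
Proof.
move=> iu iv; have iau := integrableZl measurableT a iu.
have ibv := integrableZl measurableT b iv.
by apply: eq_integrable (integrableD measurableT iau ibv).
Qed.

Lemma Rintegral_comb (R : realType) (a b : R) (u v : R -> R) :
  lebesgue_measure.-integrable setT (EFin \o u) ->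
  lebesgue_measure.-integrable setT (EFin \o v) ->
  \int[lebesgue_measure]_(x in setT) (a * u x + b * v x) =
  a * \int[lebesgue_measure]_(x in setT) u x +
  b * \int[lebesgue_measure]_(x in setT) v x.
Proof.
move=> iu iv; rewrite RintegralD // ?RintegralZl //.
- by apply: eq_integrable (integrableZl measurableT a iu).
- by apply: eq_integrable (integrableZl measurableT b iv).
Qed.

Lemma cintegrable_linear (R : realType) (z : R[i]) (g h : R -> R[i]) :
  cintegrable g -> cintegrable h -> cintegrable (fun x => z * g x + h x).
Proof.
move=> [g1 g2] [h1 h2]; split.
  under eq_fun do rewrite ReD ReM -mulNr -[X in _ + X]mul1r.
  have := integrable_comb 1 1 (integrable_comb (complex.Re z)
    (- complex.Im z) g1 g2) h1.
  by under eq_fun do rewrite mul1r.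
under eq_fun do rewrite ImD ImM -[X in _ + X]mul1r.
have := integrable_comb 1 1 (integrable_comb (complex.Re z)
  (complex.Im z) g2 g1) h2.
by under eq_fun do rewrite mul1r.
Qed.

Lemma cintegral_linear (R : realType) (z : R[i]) (g h : R -> R[i]) :
  cintegrable g -> cintegrable h ->
  cintegral (fun x => z * g x + h x) = z * cintegral g + cintegral h.
Proof.
move=> [g1 g2] [h1 h2]; apply: eq_ReIm.
  rewrite ReD ReM /=.
  under eq_Rintegral do rewrite ReD ReM -mulNr.
  rewrite RintegralD // ?Rintegral_comb // ?mulNr //.
  exact: integrable_comb.
rewrite ImD ImM /=.
under eq_Rintegral do rewrite ImD ImM.
rewrite RintegralD // ?Rintegral_comb //.
exact: integrable_comb.
Qed.

Lemma cintegrable0 (R : realType) : cintegrable (fun _ : R => 0).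
Proof. by split; exact: integrable0. Qed.

Lemma cintegral0 (R : realType) : cintegral (fun _ : R => 0) = 0.
Proof.
by apply: eq_ReIm; rewrite /= /Rintegral integral0.
Qed.

Lemma cintegrable_sum (R : realType) (m : nat) (g : 'I_m -> R -> R[i]) :
  (forall a, cintegrable (g a)) -> cintegrable (fun x => \sum_a g a x).
Proof.
move=> ig; elim: (index_enum _) => [|a s IH].
  by under eq_fun do rewrite big_nil; exact: cintegrable0.
under eq_fun do rewrite big_cons -[g a _]mul1r.
exact: cintegrable_linear.
Qed.

Lemma cintegral_sum (R : realType) (m : nat) (g : 'I_m -> R -> R[i]) :
  (forall a, cintegrable (g a)) ->
  cintegral (fun x => \sum_a g a x) = \sum_a cintegral (g a).
Proof.
move=> ig.
suff [//] : cintegrable (fun x => \sum_a g a x) /\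
  cintegral (fun x => \sum_a g a x) = \sum_a cintegral (g a).
elim: (index_enum _) => [|a s [IH1 IH2]].
  under eq_fun do rewrite big_nil; rewrite big_nil cintegral0.
  by split=> //; exact: cintegrable0.
under eq_fun do rewrite big_cons -[g a _]mul1r.
split; first exact: cintegrable_linear.
by rewrite cintegral_linear // mul1r IH2 big_cons.
Qed.

Lemma cintegrableZ (R : realType) (z : R[i]) (g : R -> R[i]) :
  cintegrable g -> cintegrable (fun x => z * g x).
Proof.
move=> ig; have := cintegrable_linear z ig (@cintegrable0 R).
by under eq_fun do rewrite addr0.
Qed.

Lemma cintegralZ (R : realType) (z : R[i]) (g : R -> R[i]) :
  cintegrable g -> cintegral (fun x => z * g x) = z * cintegral g.
Proof.
move=> ig; have := cintegral_linear z ig (@cintegrable0 R).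
by under eq_fun do rewrite addr0; rewrite cintegral0 addr0.
Qed.

(** Fubini's theorem for the approximating measures is finite additivity. *)
Lemma cantor_mean_cintegral (R : realType) (m : nat) (c : R) (n : nat)
    (G : R -> R -> R[i]) : (forall t, cintegrable (G t)) ->
  cantor_mean m c n (fun t => cintegral (G t)) =
  cintegral (fun x => cantor_mean m c n (G^~ x)).
Proof.
move=> iG.
suff [//] : cintegrable (fun x => cantor_mean m c n (G^~ x)) /\
  cantor_mean m c n (fun t => cintegral (G t)) =
  cintegral (fun x => cantor_mean m c n (G^~ x)).
elim: n G iG => [|n IH] G iG /=; first by split=> //; exact: iG.
have IHa (a : 'I_m) := IH (fun t => G (digit_map m c a t)) (fun t => iG _).
split; first by apply: cintegrableZ; apply: cintegrable_sum => a; case: (IHa a).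
rewrite cintegralZ; last by apply: cintegrable_sum => a; case: (IHa a).
rewrite cintegral_sum; last by move=> a; case: (IHa a).
by congr (_ * _); apply: eq_bigr => a _; case: (IHa a).
Qed.

Lemma Rintegral_cvg (R : realType) (u : nat -> R -> R) (v h : R -> R) :
  (forall n, measurable_fun setT (u n)) ->
  (forall x, u n x @[n --> \oo] --> v x) ->
  lebesgue_measure.-integrable setT (EFin \o h) ->
  (forall n x, `|u n x| <= h x) ->
  \int[lebesgue_measure]_(x in setT) u n x @[n --> \oo] -->
    \int[lebesgue_measure]_(x in setT) v x.
Proof.
move=> meas_u uv ih uh.
have mv : measurable_fun setT v.
  by apply: (measurable_fun_cvg (h := u)) => // x _; exact: uv.
have [||||iv _ cv] := @dominated_convergence _ _ R lebesgue_measure setT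
  measurableT (fun n => EFin \o u n) (EFin \o v) (EFin \o h) _ _ _ ih _.
(* lebesgue_measure sees R as the Borel space generated by half-open intervals;
   the two measurability statements are convertible, not syntactically equal *)
- by move=> n; apply/measurable_EFinP; exact (meas_u n).
- by apply/measurable_EFinP; exact mv.
- by apply: aeW => x _; apply: cvg_EFin; [exact: nearW|exact: uv].
- by apply: aeW => x n _; rewrite /= lee_fin.
apply: fine_cvg.
by rewrite fineK //; exact: integrable_fin_num.
Qed.

Lemma cintegral_cvg (R : realType) (u : nat -> R -> R[i]) (v : R -> R[i])
    (h : R -> R) :
  (forall n, measurable_fun setT (fun x => complex.Re (u n x)) /\
             measurable_fun setT (fun x => complex.Im (u n x))) ->
  (forall x, ccvg (u ^~ x) (v x)) ->
  lebesgue_measure.-integrable setT (EFin \o h) ->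
  (forall n x, cmod (u n x) <= h x) ->
  ccvg (fun n => cintegral (u n)) (cintegral v).
Proof.
move=> meas_u uv ih uh; split; apply: Rintegral_cvg ih _.
- by move=> n; case: (meas_u n).
- by move=> x; case: (uv x).
- by move=> n x; apply: le_trans (uh n x); exact: le_Re_cmod.
- by move=> n; case: (meas_u n).
- by move=> x; case: (uv x).
- by move=> n x; apply: le_trans (uh n x); exact: le_Im_cmod.
Qed.

Lemma integrable_oneDsqrV (R : realType) (B : R) :
  lebesgue_measure.-integrable setT
    (EFin \o (fun x : R => B * (1 + x ^+ 2)^-1)).
Proof.
suff iV : lebesgue_measure.-integrable setT
    (EFin \o (fun x : R => (1 + x ^+ 2)^-1)).
  by apply: eq_integrable (integrableZl measurableT B iV).
have cf : continuous (fun x : R => (1 + x ^+ 2)^-1).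
  exact: continuous_oneDsqrV.
have f0 (x : R) : 0 <= (1 + x ^+ 2)^-1 by rewrite invr_ge0 addr_ge0 ?sqr_ge0.
apply/integrableP; split.
  by apply/measurable_EFinP; exact (continuous_measurable_fun cf).
under eq_integral do rewrite /= ger0_norm //.
rewrite ge0_symfun_integralT //; last by move=> x /=; rewrite sqrrN.
rewrite -set_itvcy integral0y_oneDsqr -EFinM ltry.
by [].
Qed.

Lemma cintegrable_dominated (R : realType) (g : R -> R[i]) (h : R -> R) :
  measurable_fun setT (fun x => complex.Re (g x)) ->
  measurable_fun setT (fun x => complex.Im (g x)) ->
  lebesgue_measure.-integrable setT (EFin \o h) ->
  (forall x, cmod (g x) <= h x) -> cintegrable g.
Proof.
move=> m1 m2 ih gh; split; apply: le_integrable ih => //.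
- by apply/measurable_EFinP; exact m1.
- move=> x _ /=; rewrite lee_fin; apply: le_trans (ler_norm _).
  by apply: le_trans (gh x); exact: le_Re_cmod.
- by apply/measurable_EFinP; exact m2.
- move=> x _ /=; rewrite lee_fin; apply: le_trans (ler_norm _).
  by apply: le_trans (gh x); exact: le_Im_cmod.
Qed.

(** * Schwartz functions *)

Lemma supnorm_leP (R : realType) (A : set R) (f : R -> R[i]) (M : R) :
  (supnorm A f <= M%:E)%E <-> forall x, A x -> cmod (f x) <= M.
Proof.
split=> [fM x Ax|fM].
  rewrite -lee_fin; apply: le_trans fM; apply: ereal_sup_ubound.
  by exists x.
by apply: ge_ereal_sup => _ [x Ax <-]; rewrite lee_fin; exact: fM.
Qed.

Lemma supnorm_lty (R : realType) (f : R -> R[i]) :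
  (supnorm setT f < +oo)%E ->
  exists2 M : R, supnorm setT f = M%:E & forall x, cmod (f x) <= M.
Proof.
move=> fy; have f_ge (x : R) : ((cmod (f x))%:E <= supnorm setT f)%E.
  by apply: ereal_sup_ubound; exists x.
have fin : supnorm setT f \is a fin_num.
  rewrite ge0_fin_numE //; apply: le_trans (f_ge 0).
  by rewrite lee_fin cmod_ge0.
exists (fine (supnorm setT f)); first by rewrite fineK.
by move=> x; rewrite -lee_fin fineK.
Qed.

Lemma ccontinuous_lipschitz (R : realType) (f : R -> R[i]) (M : R) :
  (forall x y, cmod (f x - f y) <= M * `|x - y|) -> ccontinuous f.
Proof.
move=> fM.
have lip (g : R -> R) : (forall x y, `|g x - g y| <= cmod (f x - f y)) ->
    continuous g.
  move=> gf x; apply/cvgrPdist_le => e e0.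
  have d0 : 0 < e / (`|M| + 1) by rewrite divr_gt0 ?ltr_wpDl.
  have /cvgrPdist_le/(_ _ d0) close : (id : R -> R) y @[y --> x] --> x.
    exact: cvg_id.
  apply: filterS close => y; rewrite ler_pdivlMr ?ltr_wpDl // mulrC => xy.
  apply: le_trans xy; apply: le_trans (gf x y) _; apply: le_trans (fM x y) _.
  by rewrite ler_wpM2r // (le_trans (ler_norm M)) // lerDl.
split; apply: lip => x y; [rewrite -ReN -ReD|rewrite -ImN -ImD].
  exact: le_Re_cmod.
exact: le_Im_cmod.
Qed.

Lemma ccontinuousM (R : realType) (f g : R -> R[i]) :
  ccontinuous f -> ccontinuous g -> ccontinuous (fun x => f x * g x).
Proof.
move=> [f1 f2] [g1 g2]; split=> x.
  under eq_fun do rewrite ReM.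
  by apply: cvgB; apply: cvgM; [exact: f1|exact: g1|exact: f2|exact: g2].
under eq_fun do rewrite ImM.
by apply: cvgD; apply: cvgM; [exact: f1|exact: g2|exact: f2|exact: g1].
Qed.

Lemma ccontinuous_cexpi (R : realType) (t : R) :
  ccontinuous (fun x => cexpi (t * x)).
Proof.
apply: (@ccontinuous_lipschitz _ _ (2 * `|t|)) => x y.
by apply: le_trans (cexpi_lipschitz _ _) _; rewrite -mulrBr normrM mulrA.
Qed.

Lemma cmod_real (R : realType) (x : R) : cmod (x%:C)%C = `|x|.
Proof. by rewrite /cmod /= expr0n /= addr0 sqrtr_sqr. Qed.

Lemma schwartz_bound (R : realType) (j k : nat) (phi : R -> R[i]) :
  schwartz phi ->
  exists2 M, 0 <= M & forall x, `|x| ^+ j * cmod (cderiven k phi x) <= M.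
Proof.
move=> [_ /(_ j k)] /supnorm_lty[M _ phiM]; exists M => [|x].
  exact: le_trans (cmod_ge0 _) (phiM 0).
by have := phiM x; rewrite cmodM cmod_real normrX.
Qed.

Lemma cderiven0 (R : realType) (phi : R -> R[i]) : cderiven 0 phi = phi.
Proof. by apply/funext => x; exact: eq_ReIm. Qed.

Lemma schwartz_ccontinuous (R : realType) (phi : R -> R[i]) :
  schwartz phi -> ccontinuous phi.
Proof.
move=> [sm _]; split=> x; apply/differentiable_continuous/derivable1_diffP.
  by case: (sm 0%N x).
by case: (sm 0%N x).
Qed.

Lemma schwartz_lipschitz (R : realType) (phi : R -> R[i]) : schwartz phi ->
  exists2 M, 0 <= M & forall x y, cmod (phi x - phi y) <= M * `|x - y|.
Proof.
move=> sphi; have [M M0 phiM] := schwartz_bound 0 1 sphi.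
have [sm _] := sphi.
exists (M + M) => [|x y]; first exact: addr_ge0.
apply: le_trans (cmod_le_ReIm _) _; rewrite mulrDl ReD ReN ImD ImN.
have phi1 z : cmod (cderiven 1 phi z) <= M.
  by apply: le_trans (phiM z); rewrite expr0 mul1r.
apply: lerD.
  apply: (@lipschitz_of_derive _ (fun t => complex.Re (phi t))) => z.
    by case: (sm 0%N z).
  by apply: le_trans (phi1 z); apply: le_trans (le_Re_cmod _).
apply: (@lipschitz_of_derive _ (fun t => complex.Im (phi t))) => z.
  by case: (sm 0%N z).
by apply: le_trans (phi1 z); apply: le_trans (le_Im_cmod _).
Qed.

Lemma schwartz_decay (R : realType) (phi : R -> R[i]) : schwartz phi ->
  exists B, forall x, cmod (phi x) <= B * (1 + x ^+ 2)^-1.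
Proof.
move=> sphi; have [B0 _ phi0] := schwartz_bound 0 0 sphi.
have [B2 _ phi2] := schwartz_bound 2 0 sphi.
exists (B0 + B2) => x; rewrite ler_pdivlMr; last first.
  by rewrite ltr_pwDl // sqr_ge0.
rewrite mulrDr mulr1 lerD //.
  by have := phi0 x; rewrite cderiven0 expr0 mul1r.
by have := phi2 x; rewrite cderiven0 real_normK ?num_real // mulrC.
Qed.

Lemma cintegrable_mul_schwartz (R : realType) (g phi : R -> R[i]) (M : R) :
  ccontinuous g -> (forall x, cmod (g x) <= M) -> schwartz phi ->
  cintegrable (fun x => g x * phi x).
Proof.
move=> cg gM sphi; have [B phiB] := schwartz_decay sphi.
have [c1 c2] := ccontinuousM cg (schwartz_ccontinuous sphi).
apply: (cintegrable_dominated _ _ (integrable_oneDsqrV (M * B))).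
- exact: continuous_measurable_fun.
- exact: continuous_measurable_fun.
- by move=> x; rewrite cmodM -mulrA ler_pM ?cmod_ge0.
Qed.

(** * The spectrum of the translates *)

(** The measure exp(- i xi t) mu as a functional: modulating mu translates its
    characteristic function by xi. *)
Definition cantor_distribution (R : realType) (m : nat) (c xi : R)
    (phi : R -> R[i]) : R[i] :=
  clim (fun n => cantor_mean m c n (fun t => cexpi (- xi * t) * phi t)).

Lemma ccvg_cantor_distribution (R : realType) (m : nat) (c xi : R)
    (phi : R -> R[i]) : (0 < m)%N -> 0 <= c -> schwartz phi ->
  ccvg (fun n => cantor_mean m c n (fun t => cexpi (- xi * t) * phi t))
    (cantor_distribution m c xi phi).
Proof.
move=> m0 c0 sphi; have [M M0 phiM] := schwartz_lipschitz sphi.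
have [B B0 phiB] := schwartz_bound 0 0 sphi.
apply: (@ccvg_cantor_mean _ _ _ _ (M + 2 * `|xi| * B)) => //.
  by rewrite addr_ge0 // !mulr_ge0.
move=> s t.
have -> : cexpi (- xi * s) * phi s - cexpi (- xi * t) * phi t =
    cexpi (- xi * s) * (phi s - phi t) +
    (cexpi (- xi * s) - cexpi (- xi * t)) * phi t by ring.
apply: le_trans (cmodD _ _) _; rewrite !cmodM cmod_cexpi mul1r mulrDl lerD //.
rewrite mulrAC ler_pM ?cmod_ge0 //.
  apply: le_trans (cexpi_lipschitz _ _) _.
  by rewrite -mulrBr normrM normrN mulrA.
by have := phiB t; rewrite cderiven0 expr0 mul1r.
Qed.

Lemma tempered_cantor_distribution (R : realType) (m : nat) (c xi : R) :
  (0 < m)%N -> 0 <= c -> tempered_distribution (cantor_distribution m c xi).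
Proof.
move=> m0 c0; split=> [a phi psi sphi spsi|].
  apply: ccvg_clim.
  have := ccvg_linear a (ccvg_cantor_distribution xi m0 c0 sphi)
    (ccvg_cantor_distribution xi m0 c0 spsi).
  congr ccvg; apply/funext => n; rewrite -cantor_mean_linear; congr cantor_mean.
  by apply/funext => t; ring.
exists 0%N, 1 => phi sphi; rewrite mul1e big_ord1 big_ord1.
have [_ /(_ 0%N 0%N) /supnorm_lty[M EM phiM]] := sphi.
rewrite /schwartz_seminorm EM lee_fin.
apply: (ccvg_cmod_le (ccvg_cantor_distribution xi m0 c0 sphi)).
apply: nearW => n; apply: (@cmod_cantor_mean_le _ _ _ setT) => // t _.
rewrite cmodM cmod_cexpi mul1r.
by have := phiM t; rewrite cderiven0 expr0 mul1r.
Qed.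

(** All points of the approximating means already belong to the limit set, since
    it contains 0 and is stable under the digit maps. *)
Lemma supported_cantor_distribution (R : realType) (m : nat) (c xi : R) :
  (0 < m)%N -> 0 <= c ->
  supported_by (cantor_distribution m c xi) (cantor_set m c).
Proof.
move=> m0 c0 phi _ disj; apply: ccvg_clim.
rewrite (_ : (fun n => _) = fun=> 0); first exact: ccvg_cst.
apply/funext => n; apply: cmod0_eq0.
apply: (@cmod_cantor_mean_le _ _ _ (cantor_set m c)) => //.
- exact: cantor_set0.
- by move=> a t; exact: cantor_set_digit.
- move=> t St; rewrite cmodM cmod_cexpi mul1r.
  suff -> : phi t = 0 by rewrite cmod0.
  apply/eqP/negPn/negP => phit.
  suff : (fsupport phi `&` cantor_set m c) t by rewrite disj.
  by split=> //; exact: subset_closure.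
Qed.

(** The functional is evaluated on the Fourier transform of phi, for which the
    means converge by dominated convergence rather than by regularity. *)
Lemma fourier_cantor_distribution (R : realType) (m : nat) (c xi : R) :
  (0 < m)%N -> 0 <= c ->
  is_fourier_transform (cantor_distribution m c xi)
    (fun x => cantor_ft m c (x - xi)).
Proof.
move=> m0 c0 phi sphi; apply/esym/ccvg_clim.
have cchar n : ccontinuous (fun x => cantor_char m c n (x - xi)).
  apply: (@ccontinuous_lipschitz _ _ (2 * c)) => x y.
  apply: le_trans (cantor_char_lipschitz n _ _ m0 c0) _.
  by rewrite opprB addrA subrK.
have mean_fourier n :
    cantor_mean m c n (fun t => cexpi (- xi * t) * fourier phi t) =
    cintegral (fun x => cantor_char m c n (x - xi) * phi x).
  have iphi t : cintegrable (fun x => cexpi (t * x) * phi x).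
    apply: (cintegrable_mul_schwartz (M := 1)) => //.
      exact: ccontinuous_cexpi.
    by move=> x; rewrite cmod_cexpi.
  rewrite /fourier; under eq_fun do rewrite -cintegralZ //.
  rewrite cantor_mean_cintegral; last by move=> t; exact: cintegrableZ.
  congr cintegral; apply/funext => x.
  rewrite mulrC -cantor_meanZ; congr cantor_mean; apply/funext => t.
  by rewrite mulrA -cexpiD mulrC; congr (_ * cexpi _); ring.
under eq_fun do rewrite mean_fourier.
have [B phiB] := schwartz_decay sphi.
have cphi := schwartz_ccontinuous sphi.
apply: (cintegral_cvg _ _ (integrable_oneDsqrV B)).
- by move=> n; split; apply: continuous_measurable_fun;
    case: (ccontinuousM (cchar n) cphi).
- move=> x; have := ccvg_linear (phi x) (ccvg_cantor_char (x - xi) m0 c0)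
    (ccvg_cst 0).
  rewrite addr0 mulrC; congr ccvg; apply/funext => n.
  by rewrite addr0 mulrC.
- move=> n x; rewrite cmodM; apply: le_trans (phiB x).
  by rewrite -[leRHS]mul1r ler_wpM2r ?cmod_ge0 ?cmod_cantor_char_le1.
Qed.

Lemma bernstein_cantor_ft (R : realType) (m : nat) (c xi : R) :
  (0 < m)%N -> 0 <= c ->
  bernstein (cantor_set m c) (fun x => cantor_ft m c (x - xi)).
Proof.
move=> m0 c0; split.
- apply: (@ccontinuous_lipschitz _ _ (2 * c)) => x y.
  apply: le_trans (cantor_ft_lipschitz _ _ m0 c0) _.
  by rewrite opprB addrA subrK.
- apply: (@le_lt_trans _ _ 1%:E); last exact: ltry.
  by apply/supnorm_leP => x _; exact: cmod_cantor_ft_le1.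
- exists (cantor_distribution m c xi); split.
  + exact: tempered_cantor_distribution.
  + exact: supported_cantor_distribution.
  + exact: fourier_cantor_distribution.
Qed.

Lemma separation_le (R : realType) (L : set R) (x y : R) :
  L x -> L y -> x <> y -> (separation L <= `|x - y|%:E)%E.
Proof.
by move=> Lx Ly xy; apply: ereal_inf_lbound; exists (x, y).
Qed.

Theorem proposition1 (R : realType) :
  exists S : R -> \bar R -> set R,
    forall (d : R) (L : set R), 0 < d -> d < 1 -> uniformly_discrete L ->
      [/\ compact (S d (separation L)),
          lebesgue_measure (S d (separation L)) = 0%E &
          exists f : R -> R -> R[i],
            [/\ forall xi : R, L xi -> bernstein (S d (separation L)) (f xi),
                (ereal_sup [set supnorm [set: R] (f xi) | xi in L] < +oo)%E &
                forall xi : R, L xi ->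
                  (supnorm L (fun x => f xi x - delta_at xi x)%R <= d%:E)%E]].
Proof.
pose q (d : R) := (Num.truncn (8 / d)).+2.
pose m d := (q d ^ 2).-1.
(* twice b / sep, so that c |x - xi| exceeds b for x != xi *)
pose c d (s : \bar R) := 2 * (q d ^ 2)%:R / fine s.
exists (fun d s => cantor_set (m d) (c d s)) => d L d0 d1 sepL.
have m0 : (0 < m d)%N by rewrite /m -subn1 subn_gt0 (ltn_exp2l 0).
have c0 : 0 <= c d (separation L).
  by rewrite /c divr_ge0 // fine_ge0 // ltW.
split; [exact: compact_cantor_set|exact: measure_cantor_set|].
exists (fun xi x => cantor_ft (m d) (c d (separation L)) (x - xi)); split.
- by move=> xi _; exact: bernstein_cantor_ft.
- apply: (@le_lt_trans _ _ 1%:E); last exact: ltry.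
  apply: ge_ereal_sup => _ [xi _ <-].
  by apply/supnorm_leP => x _; exact: cmod_cantor_ft_le1.
- move=> xi Lxi; apply/supnorm_leP => x Lx; rewrite /delta_at.
  have [->|/eqP xxi] := eqVneq x xi.
    by rewrite subrr cantor_ft0 // subrr cmod0 ltW.
  rewrite subr0.
  have qd : 8 / (q d)%:R <= d.
    rewrite ler_pdivrMr // mulrC -ler_pdivrMr //.
    by apply: ltW; apply: lt_trans (truncnS_gt _) _; rewrite ltr_nat.
  apply: le_trans qd; apply: cmod_cantor_ft_small => //.
  have := separation_le Lx Lxi xxi.
  have := sepL; rewrite /uniformly_discrete /c.
  case: (separation L) => [s| |] //=; rewrite lte_fin lee_fin => s0 sx.
  rewrite normrM ger0_norm; last by rewrite divr_ge0 // ltW.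
  rewrite mulrAC ltr_pdivlMr //.
  have b0 : 0 < (q d ^ 2)%:R :> R by rewrite ltr0n expn_gt0.
  have : (q d ^ 2)%:R * s <= (q d ^ 2)%:R * `|x - xi| by rewrite ler_pM2l.
  have : 0 < (q d ^ 2)%:R * s by rewrite mulr_gt0.
  lra.
Qed.
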